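(* Every positive odd number occurs in one of the following diagonal arrays. For each integer $n\ge 0$ with $n\not\equiv 1\bmod 3$, the diagonal array of $n$ consists of the numbers $v_{i,j}$, $0\le i\le j$, defined by: $u_0=4n+1$ and $u_i=2u_{i-1}+1$ for $i\ge1$; $v_{0,j}=u_j$ for $j\ge 0$; $v_{k,k}=3v_{k-1,k-1}+2$ for $k\ge 1$; and $v_{i,j}=2v_{i,j-1}+1$ for $j>i$. That is, for every positive odd integer $a$ there exist an integer $n\ge 0$ with $n\not\equiv 1\bmod 3$ and indices $0\le i\le j$ such that $a=v_{i,j}$ in the array of $n$. *)

(* Defs.v *)
From mathcomp Require Import all_boot.
Set Implicit Arguments.
Unset Strict Implicit.
Unset Printing Implicit Defensive.

Fixpoint u (n i : nat) : nat :=
  if i is i'.+1 then 2 * u n i' + 1 else 4 * n + 1.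

Fixpoint vdiag (n k : nat) : nat :=
  if k is k'.+1 then 3 * vdiag n k' + 2 else u n 0.

(* Meaningful only for i <= j: because of truncated subtraction, v n i j is the
   diagonal entry v n i i when j < i. *)
Definition v (n i j : nat) : nat :=
  if i is 0 then u n j else iter (j - i) (fun x => 2 * x + 1) (vdiag n i).

Lemma v0j n j : v n 0 j = u n j.
Proof. by []. Qed.

Lemma vkk n k : 0 < k -> v n k k = 3 * v n k.-1 k.-1 + 2.
Proof.
have vE m : v n m m = vdiag n m by case: m => [|m] //=; rewrite /v subnn.
by case: k => // k _; rewrite !vE.
Qed.

Lemma vij n i j : i < j -> v n i j = 2 * v n i j.-1 + 1.
Proof. by case: j => // j; case: i => // i lt_ij; rewrite /v subSn. Qed.

Definition in_diagonal_array (n a : nat) : Prop :=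
  exists i j : nat, i <= j /\ a = v n i j.

(* Main.v *)
(** Adding one linearises the recurrences: [2x+1] becomes doubling and [3x+2]
    becomes tripling, so [v n i j + 1 = 2^(j-i+1) * 3^i * (2n+1)].  Every even
    number [a + 1] factors in this way with [3] not dividing [2n+1], that is,
    with [n] not congruent to [1] modulo [3]. *)
Require Import Defs.
From mathcomp Require Import all_boot zify.

Lemma iter_double_succ k x :
  (iter k (fun x => 2 * x + 1) x).+1 = 2 ^ k * x.+1.
Proof. by elim: k => [|k IHk] /=; rewrite ?mul1n // expnS -mulnA -IHk; lia. Qed.

Lemma u_iter n j : u n j = iter j (fun x => 2 * x + 1) (4 * n + 1).
Proof. by elim: j => //= j ->. Qed.

Lemma vdiag_succ n k : (vdiag n k).+1 = 3 ^ k * (4 * n + 2).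
Proof. by elim: k => [|k IHk] /=; [lia | rewrite expnS -mulnA -IHk; lia]. Qed.

Lemma v_succ n i j : (v n i j).+1 = 2 ^ (j - i) * (3 ^ i * (4 * n + 2)).
Proof.
(* Row [0] is given by [u], not by [vdiag], hence the separate case. *)
case: i => [|i]; last by rewrite /v iter_double_succ vdiag_succ.
by rewrite /v u_iter iter_double_succ subn0 mul1n !addnS.
Qed.

Theorem corollary5p1 (a : nat) (a_gt0 : 0 < a) (a_odd : odd a) :
  exists n : nat, n != 1 %[mod 3] /\ in_diagonal_array n a.
Proof.
have [b co2b def_a] := pfactor_coprime (isT : prime 2) (ltn0Sn a).
have b_odd : odd b by rewrite -coprime2n.
have [m co3m def_b] := pfactor_coprime (isT : prime 3) (odd_gt0 b_odd).
have m_odd : odd m by move: b_odd; rewrite def_b oddM => /andP[].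
have m_ndvd3 : ~~ (3 %| m) by rewrite -prime_coprime.
(* As [a + 1] is even, one factor 2 can be set aside for [4n + 2 = 2(2n + 1)]. *)
have s_gt0 : 0 < logn 2 a.+1 by rewrite logn_gt0 mem_primes /= dvdn2 /= a_odd.
move: (logn 2 a.+1) (logn 3 b) def_a def_b s_gt0 => [//|s] i def_a def_b _.
have def_m : m = 2 * m./2 + 1 by lia.
(* With [m = 2n + 1], [n] is 1 mod 3 exactly when 3 divides [m]. *)
exists m./2; split; first by lia.
(* The column is chosen so that [j - i = s], the exponent of 2 left after that factor is removed. *)
exists i, (s + i); split; first exact: leq_addl.
apply: succn_inj; rewrite v_succ addnK def_a def_b [in LHS]def_m expnS.
by lia.
Qed.
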